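(* Consider the control-affine system $$\dot x=b_0(x)+\sum_{i=1}^m\omega^{p_i}b_i(x)\,u_i(k_i\omega t),\qquad p_i\in(0,1),\ k_i\in\mathbb{Q}_{>0},\ \omega>0,$$ under Assumptions A1 and A2 (see context), and let $T'=2\pi\,\mathrm{LCM}(k_1^{-1},\dots,k_m^{-1})$. Then for each $r=1,\dots,4$ the $r$-order averaging of this system (see context), rewritten in the time scale $t=\tau/\omega$, is the $(r-1)$-order Lie bracket system $$\dot z=b_0(z)+\sum_{i=1}^r L_i(z),$$ where $$L_1=0,\qquad L_2=\sum_{j_1=1}^m\sum_{j_2=j_1+1}^m\nu_{j_1j_2}[b_{j_1},b_{j_2}],\qquad L_3=\sum_{j_1=1}^m\sum_{j_2=j_1+1}^m\sum_{j_3=1}^m\nu_{j_1j_2j_3}[b_{j_3},[b_{j_1},b_{j_2}]],$$ $$L_4=\sum_{j_1=1}^m\sum_{j_2=j_1+1}^m\sum_{j_3=1}^m\sum_{j_4=j_3+1}^m\beta_{1,j_1j_2j_3j_4}\big[[b_{j_1},b_{j_2}],[b_{j_3},b_{j_4}]\big]+\sum_{j_1=1}^m\sum_{j_2=j_1+1}^m\sum_{j_3=1}^m\sum_{j_4=1}^m\beta_{2,j_1j_2j_3j_4}[[[b_{j_1},b_{j_2}],b_{j_3}],b_{j_4}].$$ Here, with $v_i(\tau)=u_i(k_i\tau)$, $U_i(\tau)=\int_0^\tau u_i(k_ip)\,dp$ and $W_{ij}(\tau)=v_j(\tau)U_i(\tau)-v_i(\tau)U_j(\tau)$, $$\nu_{j_1j_2}=\frac{\omega^{p_{j_1}+p_{j_2}-1}}{2T'}\int_0^{T'}W_{j_1j_2}(\tau)\,d\tau,\qquad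 \nu_{j_1j_2j_3}=\frac{\omega^{p_{j_1}+p_{j_2}+p_{j_3}-2}}{3T'}\int_0^{T'}U_{j_3}(\tau)W_{j_1j_2}(\tau)\,d\tau,$$ $$\beta_{1,j_1j_2j_3j_4}=\frac{\omega^{p_{j_1}+p_{j_2}+p_{j_3}+p_{j_4}-3}}{12T'}\int_0^{T'}\alpha_5(\tau)\,d\tau,\qquad \beta_{2,j_1j_2j_3j_4}=\frac{\omega^{p_{j_1}+p_{j_2}+p_{j_3}+p_{j_4}-3}}{12T'}\int_0^{T'}\big(\alpha_8(\tau)-\alpha_{10}(\tau)\big)\,d\tau,$$ with (the indices $j_1j_2j_3j_4$ of $\alpha_5,\alpha_8,\alpha_{10}$ being suppressed) $$\alpha_5(\tau)=\int_0^\tau\big(v_{j_4}(\tau)v_{j_3}(p)-v_{j_3}(\tau)v_{j_4}(p)\big)\Big(\int_0^pW_{j_1j_2}(q)\,dq\Big)dp,$$ $$\alpha_8(\tau)=v_{j_4}(\tau)\int_0^\tau\Big(\int_0^pW_{j_1j_2}(q)\,dq\Big)v_{j_3}(p)\,dp,\qquad \alpha_{10}(\tau)=\int_0^\tau W_{j_1j_2}(p)\,v_{j_3}(\tau)\,U_{j_4}(p)\,dp.$$ That is, $L_i=\omega\Lambda_i$ for $i=1,\dots,4$, where $\Lambda_i$ are the averaging terms defined in the context.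
   Context: Lie bracket convention: $[f,g]=\frac{\partial g}{\partial x}f-\frac{\partial f}{\partial x}g$. $\mathrm{LCM}$ denotes the least common multiple/period of the listed positive rationals. Assumption A1: $\mathbb{D}\subset\mathbb{R}^n$ is the domain, and for every compact $\mathbb{D}_0\subset\mathbb{D}$ and $i=0,\dots,m$, $b_i$ and all its partial derivatives of all orders are continuous and bounded on $\mathbb{D}_0$. Assumption A2: for $i=1,\dots,m$, $t\mapsto u_i(k_i\omega t)$ on $[0,\infty)$ is measurable; there are $N_i,M_i\in(0,\infty)$ with $|u_i(k_i\omega t_1)-u_i(k_i\omega t_2)|\le N_i|t_1-t_2|$ for all $t_1,t_2\ge0$ and $\sup_t|u_i(k_i\omega t)|\le M_i$; it is $T$-periodic with $\int_0^Tu_i(k_i\omega t)\,dt=0$, where $T=(2\pi/\omega)\mathrm{LCM}(k_1^{-1},\dots,k_m^{-1})$. In the time $\tau=\omega t$ the period is $T'=\omega T$. Averaging: in the time $\tau=\omega t$ the system is $\frac{dx}{d\tau}=\frac1\omega b_0(x)+\frac1\omega\sum_i\omega^{p_i}u_i(k_i\tau)b_i(x)$. The second term is written $\epsilon f_\tau(x)$ with $\epsilon=\omega^{p^*-1}$ for some $p^*\in(0,1)$, $\eta_i=\omega^{p_i-p^*}$ and $f_\tau=\sum_i\eta_iu_i(k_i\tau)b_i$. The drift term $\frac1\omega b_0$, being independent of $\tau$, is by convention its own average and is added to the average of the second term. The $r$-order averaging ($r\le4$) is the autonomous system $\frac{d\bar x}{d\tau}=\frac1\omega b_0(\bar x)+\sum_{i=1}^r\Lambda_i(\bar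 x)$ with $$\Lambda_1=\frac{\epsilon}{T'}\int_0^{T'}f_\tau\,d\tau,\qquad \Lambda_2=\frac{\epsilon^2}{2!\,T'}\int_0^{T'}\Big[\int_0^\tau f_p\,dp,f_\tau\Big]d\tau,$$ $$\Lambda_3=\frac{\epsilon^3}{3!}\Big(-\frac32[\Lambda_1,\Lambda_2]+\frac{2}{T'}\int_0^{T'}\Big[\int_0^\tau f_p\,dp,\Big[\int_0^\tau f_p\,dp,f_\tau\Big]\Big]d\tau\Big),$$ $$\Lambda_4=\frac{2\epsilon^4}{4!\,T'}\int_0^{T'}\Big(\int_0^\tau\Big[\int_0^p\Big[\int_0^qf_r\,dr,f_q\Big]dq,[f_p,f_\tau]\Big]dp+\Big[\int_0^\tau\Big[\int_0^p\Big[\int_0^qf_r\,dr,f_q\Big]dq,f_p\Big]dp,f_\tau\Big]+\int_0^\tau\Big[\int_0^pf_q\,dq,\Big[\Big[\int_0^pf_q\,dq,f_p\Big],f_\tau\Big]\Big]dp\Big)d\tau.$$ *)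

(* Defs.v *)
(* MathComp-Analysis *)
From HB Require Import structures.
From mathcomp Require Import all_boot all_order all_algebra.
From mathcomp Require Import all_classical all_reals all_analysis.
From mathcomp Require Import ring.

Set Implicit Arguments.
Unset Strict Implicit.
Unset Printing Implicit Defensive.

Import Order.TTheory GRing.Theory Num.Theory.
Import numFieldNormedType.Exports.

Local Open Scope classical_set_scope.
Local Open Scope ring_scope.

Section vector_fields.
Context {R : realType} {n : nat}.
Local Notation V := 'rV[R]_n.

(* The partial derivative along the sequence of coordinate directions s, the
   last element of s being differentiated first. *)
Definition iter_partial (s : seq 'I_n) (g : V -> V) : V -> V :=
  foldr (fun j h x => 'D_(delta_mx 0 j) h x) g s.

(* 'D_v h x has a default value when the limit does not exist, so the existence
   of the partial derivatives is a separate clause. *)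
Definition smooth_bounded (D : set V) (g : V -> V) : Prop :=
  (forall (s : seq 'I_n) (j : 'I_n) (x : V), D x ->
     derivable (iter_partial s g) x (delta_mx 0 j)) /\
  (forall D0 : set V, compact D0 -> D0 `<=` D -> forall s : seq 'I_n,
     {within D0, continuous (iter_partial s g)} /\
     exists M : R, forall x, D0 x -> `|iter_partial s g x| <= M).

(* [f, g] = (dg/dx) f - (df/dx) g. Points are row vectors, and jacobian acts on
   them from the right. *)
Definition lie (f g : V -> V) : V -> V :=
  fun x => f x *m jacobian g x - g x *m jacobian f x.

(* The vector field x |-> \int_0^a g_s(x) ds, computed componentwise. *)
Definition time_int (a : R) (g : R -> V -> V) : V -> V :=
  fun x => \row_j \int[lebesgue_measure]_(s in `[0, a]) (g s x 0 j).

(* z solves z' = F(z) in D on the time interval J; the derivative is one-sided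
   at an endpoint of J that belongs to J. *)
Definition solves (D : set V) (J : set R) (F : V -> V) (z : R -> V) : Prop :=
  forall t, J t ->
    D (z t) /\ (s - t)^-1 *: (z s - z t) @[s --> within J t^'] --> F (z t).

(* The i-th averaging term of dx/dtau = eps f_tau(x), f being T'-periodic. *)
Section averaging.
Variables (eps T' : R) (f : R -> V -> V).

Local Notation F1 t := (time_int t f).
Local Notation F2 t := (time_int t (fun q => lie (F1 q) (f q))).

Definition Lambda1 : V -> V := fun x => (eps / T') *: time_int T' f x.

Definition Lambda2 : V -> V := fun x =>
  (eps ^+ 2 / (2`!%:R * T')) *: time_int T' (fun tau => lie (F1 tau) (f tau)) x.

Definition Lambda3 : V -> V := fun x =>
  (eps ^+ 3 / 3`!%:R) *:
    (- (3 / 2) *: lie Lambda1 Lambda2 x +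
     (2 / T') *:
       time_int T' (fun tau => lie (F1 tau) (lie (F1 tau) (f tau))) x).

Definition Lambda4 : V -> V := fun x =>
  (2 * eps ^+ 4 / (4`!%:R * T')) *:
    time_int T' (fun tau y =>
      time_int tau (fun p => lie (F2 p) (lie (f p) (f tau))) y +
      lie (time_int tau (fun p => lie (F2 p) (f p))) (f tau) y +
      time_int tau
        (fun p => lie (F1 p) (lie (lie (F1 p) (f p)) (f tau))) y) x.

Definition Lambda (i : nat) : V -> V :=
  match i with
  | 1 => Lambda1 | 2 => Lambda2 | 3 => Lambda3 | 4 => Lambda4
  | _ => fun=> 0
  end.

(* Right-hand side of the r-order averaging of dx/dtau = c(x) + eps f_tau(x),
   where the tau-independent term c is its own average. *)
Definition averaged_field (c : V -> V) (r : nat) : V -> V :=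
  fun x => c x + \sum_(1 <= i < r.+1) Lambda i x.

End averaging.

End vector_fields.

(* L is the least positive common integer multiple of the rationals q i. There is
   none for m = 0. *)
Definition is_rat_lcm {m : nat} (q : 'I_m -> rat) (L : rat) : Prop :=
  let common_multiple (M : rat) :=
    0 < M /\ forall i, exists a : nat, M = a%:R * q i in
  common_multiple L /\ forall M, common_multiple M -> L <= M.

Lemma is_rat_lcm_exists (m : nat) (q : 'I_m.+1 -> rat) :
  (forall i, 0 < q i) -> exists L, is_rat_lcm q L.
Proof.
move=> q0.
pose P (a : nat) := (0 < a)%N && [forall i, (a%:R * q ord0 / q i) \is a Num.nat].
have PE (a : nat) : P a <->
    0 < a%:R * q ord0 /\ forall i, exists c : nat, a%:R * q ord0 = c%:R * q i.
  split=> [/andP[a0 /forallP aq]|[]].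
    split=> [|i]; first by rewrite mulr_gt0// ltr0n.
    have /natrP[c ce] := aq i.
    by exists c; rewrite -ce divfK// gt_eqF.
  rewrite pmulr_lgt0// ltr0n => a0 aq; rewrite /P a0; apply/forallP => i.
  by have [c ->] := aq i; rewrite mulfK ?natr_nat// gt_eqF.
have exP : exists a, P a.
  exists (\prod_i (`|denq (q ord0)| * `|numq (q i)|))%N; apply/andP; split.
    by apply: prodn_gt0 => i; rewrite muln_gt0 !absz_gt0 denq_eq0 numq_eq0 gt_eqF.
  apply/forallP => i.
  have numE j : `|numq (q j)|%:R = q j * (denq (q j))%:~R :> rat.
    rewrite -[X in X * _]divq_num_den divfK ?intr_eq0 ?denq_eq0//.
    by rewrite natr_absz ger0_norm// numq_ge0 ltW.
  have denE j : `|denq (q j)|%:R = (denq (q j))%:~R :> rat.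
    by rewrite natr_absz gtr0_norm// denq_gt0.
  rewrite big_split/= [X in (_ * X)%N](bigD1 i)//= (bigD1 ord0)//=.
  set r := \prod_(_ < _ | _) _; set r' := \prod_(_ < _ | _) _.
  suff -> : (`|denq (q ord0)| * r * (`|numq (q i)| * r'))%:R * q ord0 / q i =
      (`|numq (q ord0)| * r * (`|denq (q i)| * r'))%:R :> rat by rewrite natr_nat.
  by rewrite !natrM !numE !denE; field; rewrite gt_eqF.
have [a Pa amin] := ex_minnP exP.
exists (a%:R * q ord0); split; first exact/PE.
move=> M [M0 MC]; have [c Mc] := MC ord0.
by rewrite Mc ler_pM2r// ler_nat amin//; apply/PE; rewrite -Mc.
Qed.

Section control_affine.
Context {R : realType} {n m : nat}.
Local Notation V := 'rV[R]_n.
Variables (b0 : V -> V) (b : 'I_m -> V -> V).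
Variables (u : 'I_m -> R -> R) (k : 'I_m -> rat) (p : 'I_m -> R) (omega : R).

Definition control_affine (t : R) (x : V) : V :=
  b0 x + \sum_i (omega `^ p i * u i (ratr (k i) * omega * t)) *: b i x.

(* The conditions on t |-> u_i(k_i omega t), for the period T. *)
Definition admissible_input (T : R) (i : 'I_m) : Prop :=
  let w t := u i (ratr (k i) * omega * t) in
  [/\ measurable_fun (`[0, +oo[ : set R) w,
      exists2 N : R, 0 < N &
        forall t1 t2, 0 <= t1 -> 0 <= t2 -> `|w t1 - w t2| <= N * `|t1 - t2|,
      exists2 M : R, 0 < M & forall t, 0 <= t -> `|w t| <= M,
      forall t, 0 <= t -> w (t + T) = w t &
      \int[lebesgue_measure]_(t in `[0, T]) w t = 0].

Definition v (i : 'I_m) (tau : R) : R := u i (ratr (k i) * tau).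

(* In the time tau = omega t the input-dependent part of the system is
   eps f_tau(x), where eps = omega^(pstar - 1) and
   f_tau = \sum_i omega^(p_i - pstar) u_i(k_i tau) b_i. *)
Definition avg_eps (pstar : R) : R := omega `^ (pstar - 1).

Definition avg_f (pstar : R) (tau : R) (x : V) : V :=
  \sum_i (omega `^ (p i - pstar) * v i tau) *: b i x.

Lemma control_affine_tau (pstar tau : R) (x : V) : 0 < omega ->
  omega^-1 *: control_affine (tau / omega) x =
  omega^-1 *: b0 x + avg_eps pstar *: avg_f pstar tau x.
Proof.
move=> w0; rewrite /control_affine scalerDr !scaler_sumr; congr (_ + _).
apply: eq_bigr => i _; rewrite !scalerA; congr (_ *: _).
rewrite /v /avg_eps -(mulrA (ratr _)) [omega * _]mulrC divfK ?gt_eqF// !mulrA.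
congr (_ * _); rewrite -powR_inv1 ?ltW// -!powRD; last 2 first.
- by rewrite (gt_eqF w0) implybT.
- by rewrite (gt_eqF w0) implybT.
by congr (_ `^ _); ring.
Qed.

(* Right-hand side, in the time tau, of the r-order averaging of the system. *)
Definition averaging (pstar T' : R) (r : nat) : V -> V :=
  averaged_field (avg_eps pstar) T' (avg_f pstar)
    (fun x => omega^-1 *: b0 x) r.

Definition U (i : 'I_m) (tau : R) : R :=
  \int[lebesgue_measure]_(s in `[0, tau]) v i s.

Definition W (i j : 'I_m) (tau : R) : R := v j tau * U i tau - v i tau * U j tau.

Definition intW (i j : 'I_m) (tau : R) : R :=
  \int[lebesgue_measure]_(q in `[0, tau]) W i j q.

Definition alpha5 (j1 j2 j3 j4 : 'I_m) (tau : R) : R :=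
  \int[lebesgue_measure]_(s in `[0, tau])
    ((v j4 tau * v j3 s - v j3 tau * v j4 s) * intW j1 j2 s).

Definition alpha8 (j1 j2 j3 j4 : 'I_m) (tau : R) : R :=
  v j4 tau * \int[lebesgue_measure]_(s in `[0, tau]) (intW j1 j2 s * v j3 s).

Definition alpha10 (j1 j2 j3 j4 : 'I_m) (tau : R) : R :=
  \int[lebesgue_measure]_(s in `[0, tau]) (W j1 j2 s * v j3 tau * U j4 s).

Section coefficients.
Variable T' : R.

Definition nu2 (j1 j2 : 'I_m) : R :=
  omega `^ (p j1 + p j2 - 1) / (2 * T') *
  \int[lebesgue_measure]_(tau in `[0, T']) W j1 j2 tau.

Definition nu3 (j1 j2 j3 : 'I_m) : R :=
  omega `^ (p j1 + p j2 + p j3 - 2) / (3 * T') *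
  \int[lebesgue_measure]_(tau in `[0, T']) (U j3 tau * W j1 j2 tau).

Definition beta1 (j1 j2 j3 j4 : 'I_m) : R :=
  omega `^ (p j1 + p j2 + p j3 + p j4 - 3) / (12 * T') *
  \int[lebesgue_measure]_(tau in `[0, T']) alpha5 j1 j2 j3 j4 tau.

Definition beta2 (j1 j2 j3 j4 : 'I_m) : R :=
  omega `^ (p j1 + p j2 + p j3 + p j4 - 3) / (12 * T') *
  \int[lebesgue_measure]_(tau in `[0, T'])
    (alpha8 j1 j2 j3 j4 tau - alpha10 j1 j2 j3 j4 tau).

Definition L2 : V -> V := fun x =>
  \sum_(j1 < m) \sum_(j2 < m | (j1 < j2)%N)
    nu2 j1 j2 *: lie (b j1) (b j2) x.

Definition L3 : V -> V := fun x =>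
  \sum_(j1 < m) \sum_(j2 < m | (j1 < j2)%N) \sum_(j3 < m)
    nu3 j1 j2 j3 *: lie (b j3) (lie (b j1) (b j2)) x.

Definition L4 : V -> V := fun x =>
  (\sum_(j1 < m) \sum_(j2 < m | (j1 < j2)%N)
     \sum_(j3 < m) \sum_(j4 < m | (j3 < j4)%N)
       beta1 j1 j2 j3 j4 *: lie (lie (b j1) (b j2)) (lie (b j3) (b j4)) x) +
  (\sum_(j1 < m) \sum_(j2 < m | (j1 < j2)%N) \sum_(j3 < m) \sum_(j4 < m)
       beta2 j1 j2 j3 j4 *: lie (lie (lie (b j1) (b j2)) (b j3)) (b j4) x).

Definition Lterm (i : nat) : V -> V :=
  match i with
  | 2 => L2 | 3 => L3 | 4 => L4
  | _ => fun=> 0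
  end.

(* Right-hand side of the (r-1)-order Lie bracket system. *)
Definition lie_bracket_system (r : nat) : V -> V :=
  fun x => b0 x + \sum_(1 <= i < r.+1) Lterm i x.

End coefficients.
End control_affine.

(* Main.v *)
(* With X_i = omega^(p_i - pstar) b_i, the averaged vector field reads
   f_tau = \sum_i v_i(tau) X_i with coefficients that depend on tau only. Time
   integrals act on the coefficients and the bracket is bilinear on
   differentiable fields, so each Lambda_i is a combination of iterated brackets
   of the X_i whose coefficients are iterated integrals of the v_i;
   antisymmetry folds \sum_(i, j) U_i v_j [X_i, X_j] into
   \sum_(i < j) W_ij [X_i, X_j]. The zero mean of the inputs gives Lambda_1 = 0,
   which also removes the correction term of Lambda_3. The identities only hold
   on D, which is open, so they may be differentiated inside further brackets.
*)
Require Import Defs.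
From HB Require Import structures.
From mathcomp Require Import all_boot all_order all_algebra.
From mathcomp Require Import all_classical all_reals all_analysis.
From mathcomp Require Import ring.

Import Order.TTheory GRing.Theory Num.Theory.
Import numFieldNormedType.Exports.

Local Open Scope classical_set_scope.
Local Open Scope ring_scope.

Set Implicit Arguments.
Unset Strict Implicit.
Unset Printing Implicit Defensive.

(** * Fréchet differentiability read off from a first-order expansion *)

Lemma differentiable_approx (R : numFieldType) (V W : normedModType R)
    (f : V -> W) (df : {linear V -> W}) (x : V) :
  continuous df ->
  (forall e : R, 0 < e ->
     \forall h \near 0, `|f (h + x) - f x - df h| <= e * `|h|) ->
  differentiable f x /\ 'd f x = df :> (V -> W).
Proof.
move=> cdf fdf.
have fE : f \o shift x = cst (f x) + df +o_ 0 id.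
  apply/eqaddoP => e e0; apply: filterS (fdf e e0) => h.
  by rewrite /= !fctE opprD addrA.
have dE := diff_unique cdf fE.
by split=> //; apply/diff_locallyP; rewrite dE.
Qed.

(** The first-order expansion at [x] only involves values near [x]. The vector fields below are
    identified on an open set only, and this transfers their differentiability. *)
Lemma near_eq_differentiable (R : numFieldType) (V W : normedModType R)
    (f g : V -> W) (x : V) :
  {near x, f =1 g} -> differentiable f x -> differentiable g x.
Proof.
move=> fg dfx; apply: (@differentiable_approx _ _ _ g ('d f x) x _ _).1.
  exact: diff_continuous.
move=> e e0.
have /eqaddoP/(_ e e0) fE := diff_locally dfx.
near=> h.
have <- : f (h + x) = g (h + x).
  near: h.
  have := fg; rewrite [X in X -> _](near_shift 0)/=.
  by apply: filterS => h /=; rewrite subr0.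
rewrite -(nbhs_singleton fg).
have : `|(f \o shift x - (cst (f x) + 'd f x)) h| <= e * `|h| by near: h.
by rewrite !fctE /= opprD addrA.
Unshelve. all: by end_near. Qed.

(** * Differentiability of functions with continuous partial derivatives *)

Section C1.
Context {R : realType} {n : nat}.
Local Notation V := 'rV[R]_n.
Local Notation "''e_' j" := (@delta_mx R 1 n 0 j) (at level 8, j at level 2).

(** The mean value theorem for the restriction of [g] to a line in a coordinate direction. The
    increment [c] may have either sign, so the intermediate point is located by absolute values. *)
Lemma partial_mvt (g : V -> R) (y : V) (j : 'I_n) (c : R) :
  (forall t : R, `|t| <= `|c| -> derivable g (y + t *: 'e_j) 'e_j) ->
  exists2 t : R, `|t| <= `|c| &
    g (y + c *: 'e_j) - g y = c * 'D_('e_j) g (y + t *: 'e_j).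
Proof.
move=> dg.
pose phi (t : R) := g (y + t *: 'e_j).
have phiD (t : R) : `|t| <= `|c| ->
    is_derive t (1 : R) phi ('D_('e_j) g (y + t *: 'e_j)).
  move=> /dg; rewrite /derivable /derive.
  (* The difference quotients of [g] along the line and of [phi] at [t] are the same function, so
     existence and value of the derivative carry over together. *)
  have -> : (fun h : R => h^-1 *: ((g \o shift (y + t *: 'e_j)) (h *: 'e_j) -
      g (y + t *: 'e_j))) =
      (fun h : R => h^-1 *: ((phi \o shift t) (h *: (1 : R)) - phi t)).
    apply/funext => h; rewrite /phi /= [_ *: 1]mulr1.
    by rewrite addrCA -scalerDl.
  by move=> cv; apply: DeriveDef.
have phi0 : phi 0 = g y by rewrite /phi scale0r addr0.
have phic a b : (forall t, t \in `[a, b] -> `|t| <= `|c|) ->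
    {within `[a, b], continuous phi}.
  move=> ab; apply: derivable_within_continuous => t tab.
  exact: (@ex_derive _ _ _ _ _ _ _ (phiD t (ab t tab))).
have [c0|c0] := leP 0 c.
  have le t : t \in `[0, c] -> `|t| <= `|c|.
    by rewrite in_itv/= => /andP[t0 tc]; rewrite !ger0_norm.
  have [t tc ht] := MVT_segment c0
    (fun t tc => phiD t (le t (subset_itv_oo_cc tc))) (phic _ _ le).
  by exists t; [exact: le|rewrite -phi0 -/(phi c) ht subr0 mulrC].
have le t : t \in `[c, 0] -> `|t| <= `|c|.
  rewrite in_itv/= => /andP[tc t0]; rewrite !ler0_norm ?(ltW c0)//.
  by rewrite lerN2.
have [t tc ht] := MVT_segment (ltW c0)
  (fun t tc => phiD t (le t (subset_itv_oo_cc tc))) (phic _ _ le).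
exists t; first exact: le.
by rewrite -phi0 -/(phi c) -opprB ht sub0r mulrN opprK mulrC.
Qed.

Lemma norm_delta_le (j : 'I_n) : `|'e_j| <= 1 :> R.
Proof.
rewrite /Num.Def.normr/= mx_normrE; apply: bigmax_le => // -[a i] _ /=.
by rewrite mxE; case: (_ && _); rewrite ?normr1 ?normr0.
Qed.

Lemma coord_le_norm (h : V) (j : 'I_n) : `|h 0 j| <= `|h|.
Proof.
rewrite [leRHS]/Num.Def.normr/= mx_normrE.
exact: (le_bigmax _ (fun i : 'I_1 * 'I_n => `|h i.1 i.2|) (0, j)).
Qed.

(* Telescoping over the coordinates of h: each increment is evaluated by the
   mean value theorem at a point within size s * |h| of x. *)
Lemma partials_approx (g : V -> R) (x : V) (r e : R) (s : seq 'I_n) :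
  0 <= e ->
  (forall (j : 'I_n) y, `|y - x| < r -> derivable g y 'e_j) ->
  (forall (j : 'I_n) y, `|y - x| < r ->
     `|'D_('e_j) g y - 'D_('e_j) g x| <= e) ->
  forall h : V, (size s)%:R * `|h| < r ->
    `|g (x + (\sum_(j <- s) h 0 j *: 'e_j : V)) - g x
       - \sum_(j <- s) h 0 j * 'D_('e_j) g x| <= (size s)%:R * (e * `|h|) /\
    `|\sum_(j <- s) h 0 j *: 'e_j : V| <= (size s)%:R * `|h|.
Proof.
move=> e0 dg cg h; elim: s => [_|j s IH /= hr].
  by split; rewrite !big_nil ?addr0 ?subrr ?normr0 ?mul0r ?subrr ?normr0.
have hsr : (size s)%:R * `|h| < r.
  by apply: le_lt_trans hr; rewrite ler_wpM2r// ler_nat.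
have [IH1 IH2] := IH hsr.
rewrite !big_cons.
set S := \sum_(_ <- s) _ *: _ in IH1 IH2 *.
set P := \sum_(_ <- s) _ * _ in IH1 *.
have step (t : R) : `|t| <= `|h 0 j| -> `|t *: 'e_j : V| <= `|h|.
  move=> th; rewrite normrZ -[leRHS]mulr1.
  by apply: ler_pM => //; [exact: le_trans th (coord_le_norm _ _)|];
    exact: norm_delta_le.
have close (t : R) : `|t| <= `|h 0 j| -> `|x + S + t *: 'e_j - x : V| < r.
  move=> th; apply: le_lt_trans hr.
  rewrite (_ : x + S + t *: 'e_j - x = t *: 'e_j + S); last first.
    by rewrite addrAC (addrC x) addrK addrC.
  rewrite (le_trans (ler_normD _ _))// mulrS mulrDl mul1r.
  by rewrite lerD// step.
have [t th tE] := @partial_mvt g (x + S) j (h 0 j)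
  (fun t th => dg _ _ (close t th)).
split; last first.
  by rewrite (le_trans (ler_normD _ _))// mulrS mulrDl mul1r lerD// step.
rewrite (addrC (_ *: _)) addrA.
set g2 := g (x + S + _) in tE *.
have -> : g2 - g x - (h 0 j * 'D_('e_j) g x + P) =
   h 0 j * ('D_('e_j) g (x + S + t *: 'e_j) - 'D_('e_j) g x)
    + (g (x + S) - g x - P).
  by rewrite mulrBr -tE; ring.
rewrite (le_trans (ler_normD _ _))// mulrS mulrDl mul1r lerD//.
rewrite normrM mulrC; apply: ler_pM => //; last exact: coord_le_norm.
exact/cg/close.
Qed.

(** The candidate differential sends [h] to the sum of the [h 0 j] times the partial derivatives at
    [x]. Telescoping bounds the error by [n] times the oscillation of the partials near [x], times
    the norm of [h]. *)
Lemma differentiable_C1 (g : V -> R) (x : V) :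
  (\forall y \near x, forall j : 'I_n, derivable g y 'e_j) ->
  (forall j : 'I_n, {for x, continuous (fun y => 'D_('e_j) g y)}) ->
  differentiable g x.
Proof.
move=> dg cg.
pose df (h : V) : R := \sum_j h 0 j * 'D_('e_j) g x.
have dflin : linear df.
  move=> a h1 h2; rewrite /df scaler_sumr -big_split/=; apply: eq_bigr => j _.
  by rewrite !mxE mulrDl -mulrA.
pose dfL : {linear V -> R} := HB.pack df (GRing.isLinear.Build _ _ _ _ _ dflin).
have dfc : continuous dfL.
  apply: continuous_big => [|j _ h]; first exact: add_continuous.
  apply: (@continuousM _ V (fun z : V => z 0 j) (cst _));
    [exact: coord_continuous|exact: cst_continuous].
apply: (@differentiable_approx _ _ _ g dfL x dfc _).1 => e e0.
(* With [n.+1] as divisor the tolerance makes sense for [n = 0] too, and the [n] coordinate errors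
   still add up to at most [e]. *)
have n0 : 0 < n.+1%:R :> R by [].
have e'0 : 0 < e / n.+1%:R by rewrite divr_gt0.
have cge : \forall y \near x, forall j : 'I_n,
    `|'D_('e_j) g y - 'D_('e_j) g x| <= e / n.+1%:R.
  apply: (@filter_forall V 'I_n (fun j y =>
    `|'D_('e_j) g y - 'D_('e_j) g x| <= e / n.+1%:R) (nbhs x)) => j.
  by move/cvgrPdistC_le : (cg j) => /(_ _ e'0).
pose A := [set y : V | (forall j : 'I_n, derivable g y 'e_j) /\
  forall j : 'I_n, `|'D_('e_j) g y - 'D_('e_j) g x| <= e / n.+1%:R].
have /nbhs_ballP[r /= r0 hr] : nbhs x A by exact: filterI dg cge.
have hr' y : `|y - x| < r -> (forall j : 'I_n, derivable g y 'e_j) /\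
    forall j : 'I_n, `|'D_('e_j) g y - 'D_('e_j) g x| <= e / n.+1%:R.
  by move=> yx; apply: hr; rewrite -ball_normE/= distrC.
have := @partials_approx g x r (e / n.+1%:R) (index_enum 'I_n) (ltW e'0)
  (fun j y yx => (hr' y yx).1 j) (fun j y yx => (hr' y yx).2 j).
have -> : size (index_enum 'I_n) = n by rewrite -[RHS]card_ord cardT enumT.
move=> H; near=> h.
have hs : n%:R * `|h| < r.
  apply: (@le_lt_trans _ _ (n.+1%:R * `|h|)).
    by rewrite ler_wpM2r// ler_nat.
  rewrite -ltr_pdivlMl//; near: h.
  apply: (@pseudometric_normed_Zmodule.nbhs0_lt _ V).
 by rewrite mulr_gt0 ?invr_gt0.
have [+ _] := H h hs.
rewrite -row_sum_delta (addrC x) => /le_trans; apply.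
rewrite mulrA ler_wpM2r// mulrCA -[leRHS]mulr1 ler_wpM2l ?(ltW e0)//.
by rewrite ler_pdivrMr// mul1r ler_nat.
Unshelve. all: by end_near. Qed.

End C1.

(** * Vector fields of class C^k *)

Section Ck.
Context {R : realType} {n : nat} (D : set 'rV[R]_n) (openD : open D).
Local Notation V := 'rV[R]_n.
Local Notation "''e_' j" := (@delta_mx R 1 n 0 j) (at level 8, j at level 2).

(** This says that the partial derivatives of order less than [k] are Fréchet differentiable on [D];
    continuity of those of order [k] is not part of it. In this form closure under sums, products
    and brackets is a plain induction. *)
Fixpoint Ck (k : nat) (f : V -> R) : Prop :=
  if k is k'.+1 then
    (forall x, D x -> differentiable f x) /\
    forall j, Ck k' (fun x => 'D_('e_j) f x)
  else True.

Definition Ck_field (k : nat) (F : V -> V) : Prop :=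
  forall i, Ck k (fun x => F x 0 i).

Lemma near_eq_open (f g : V -> R) (x : V) : D x ->
  (forall y, D y -> f y = g y) -> {near x, f =1 g}.
Proof. by move=> Dx fg; apply: filterS (open_nbhs_nbhs (conj openD Dx)). Qed.

(** As [D] is open, functions that agree on [D] have the same partial derivatives there, and the
    induction continues with these. *)
Lemma Ck_eq k (f g : V -> R) : (forall x, D x -> f x = g x) -> Ck k f -> Ck k g.
Proof.
elim: k f g => [//|k IH] f g fg [df dkf]; split=> [x Dx|j].
  exact: near_eq_differentiable (near_eq_open Dx fg) (df x Dx).
by apply: IH (dkf j) => x Dx; apply: near_eq_derive; exact: near_eq_open.
Qed.

Lemma CkW k (f : V -> R) : Ck k.+1 f -> Ck k f.
Proof.
by elim: k f => [//|k IH] f [df dkf]; split=> // j; exact/IH/dkf.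
Qed.

Lemma Ck_cst k (c : R) : Ck k (fun=> c).
Proof.
elim: k c => [//|k IH] c; split=> [x _|j]; first exact: differentiable_cst.
by apply: Ck_eq (IH 0) => x _; rewrite derive_cst.
Qed.

Lemma CkD k (f g : V -> R) : Ck k f -> Ck k g -> Ck k (fun x => f x + g x).
Proof.
elim: k f g => [//|k IH] f g [df dkf] [dg dkg]; split=> [x Dx|j].
  exact: differentiableD (df x Dx) (dg x Dx).
apply: Ck_eq (IH _ _ (dkf j) (dkg j)) => x Dx /=.
by rewrite -deriveD//; apply: diff_derivable; [exact: df|exact: dg].
Qed.

Lemma CkM k (f g : V -> R) : Ck k f -> Ck k g -> Ck k (fun x => f x * g x).
Proof.
elim: k f g => [//|k IH] f g Cf Cg; split=> [x Dx|j].
  exact: differentiableM (Cf.1 x Dx) (Cg.1 x Dx).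
apply: Ck_eq (CkD (IH _ _ (CkW Cf) (Cg.2 j))
  (IH _ _ (CkW Cg) (Cf.2 j))) => x Dx /=.
by rewrite -deriveM//; apply: diff_derivable; [exact: Cf.1|exact: Cg.1].
Qed.

Lemma Ck_sum k (I : Type) (r : seq I) (F : I -> V -> R) :
  (forall i, Ck k (F i)) -> Ck k (fun x => \sum_(i <- r) F i x).
Proof.
move=> CF; elim: r => [|i r IH].
  by apply: Ck_eq (Ck_cst k 0) => x _; rewrite big_nil.
by apply: Ck_eq (CkD (CF i) IH) => x _; rewrite big_cons.
Qed.

Lemma Ck_fieldW k (F : V -> V) : Ck_field k.+1 F -> Ck_field k F.
Proof. by move=> CF i; exact: CkW. Qed.

Lemma Ck_fieldZ k (c : R) (F : V -> V) :
  Ck_field k F -> Ck_field k (fun x => c *: F x).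
Proof.
by move=> CF i; apply: Ck_eq (CkM (Ck_cst k c) (CF i)) => x _; rewrite mxE.
Qed.

Lemma Ck_field_differentiable (F : V -> V) (x : V) :
  Ck_field 1 F -> D x -> differentiable F x.
Proof.
move=> CF Dx.
have -> : F = \sum_(i < n) (fun y => F y 0 i *: 'e_i).
  by apply/funext => y; rewrite fct_sumE [LHS]row_sum_delta.
apply: differentiable_sum => i; apply: differentiableZl.
by have [dF _] := CF i; exact: dF.
Qed.

Lemma derive_coord (F : V -> V) (x v : V) (i : 'I_n) :
  derivable F x v -> 'D_v (fun y => F y 0 i) x = 'D_v F x 0 i.
Proof. by move=> dF; rewrite derive_mx// mxE. Qed.

Lemma mulmx_jacobian (F : V -> V) (v x : V) (i : 'I_n) : differentiable F x ->
  (v *m jacobian F x) 0 i = \sum_j v 0 j * 'D_('e_j) (fun y => F y 0 i) x.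
Proof.
move=> dF; rewrite mxE; apply: eq_bigr => j _; congr (_ * _).
rewrite derive_coord; last exact: diff_derivable.
by rewrite deriveEjacobian// -rowE [RHS]mxE.
Qed.

(** A bracket costs one derivative: its coordinates are sums of products of a coordinate of one
    field and a first partial derivative of the other. *)
Lemma Ck_field_lie k (F G : V -> V) :
  Ck_field k.+1 F -> Ck_field k.+1 G -> Ck_field k (lie F G).
Proof.
move=> CF CG i.
pose f x := \sum_j (F x 0 j * 'D_('e_j) (fun y => G y 0 i) x) +
            (-1) * \sum_j (G x 0 j * 'D_('e_j) (fun y => F y 0 i) x).
have dH (H : V -> V) : Ck_field k.+1 H -> forall x, D x -> differentiable H x.
  by move=> CH x; apply: Ck_field_differentiable => a; have [] := CH a.
apply: (@Ck_eq _ f) => [x Dx|].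
  rewrite /f /lie mulN1r [RHS]mxE [X in _ = _ + X]mxE.
  have FG := mulmx_jacobian (F x) i (dH G CG x Dx).
  have GF := mulmx_jacobian (G x) i (dH F CF x Dx).
  by congr (_ - _); [rewrite FG|rewrite GF].
apply: CkD; last apply: CkM (Ck_cst _ _) _.
  by apply: Ck_sum => j; apply: CkM; [exact/CkW/CF|exact: (CG i).2].
by apply: Ck_sum => j; apply: CkM; [exact/CkW/CG|exact: (CF i).2].
Qed.

(** The smoothness assumption speaks of compact subsets of [D]; a small closed ball turns it into a
    statement near a point. *)
Lemma compact_nbhs (x : V) : D x ->
  exists K : set V, [/\ compact K, nbhs x K & K `<=` D].
Proof.
move=> Dx; have /nbhs_closedballP[r rD] := open_nbhs_nbhs (conj openD Dx).
exists (closed_ball x r%:num); split=> //; last first.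
  by apply/nbhs_closedballP; exists r.
apply: bounded_closed_compact; last exact: closed_ball_closed.
exists (`|x| + r%:num); split; first exact: num_real.
move=> M hM y; rewrite closed_ballE// => xy.
apply: le_trans (ltW hM); rewrite -(subKr x y).
by apply: (le_trans (ler_normB _ _)); rewrite lerD2l.
Qed.

Lemma smooth_bounded_Ck (F : V -> V) (k : nat) :
  smooth_bounded D F -> Ck_field k F.
Proof.
move=> [dF bF].
(* Differentiating prolongs [s], so the induction on [k] has to treat all iterated partials at
   once. *)
suff H s i : Ck k (fun x => iter_partial s F x 0 i).
  by move=> i; exact: (H [::]).
have pE (s' : seq 'I_n) (j : 'I_n) y : D y -> forall i',
    'D_('e_j) (fun z => iter_partial s' F z 0 i') y =
      iter_partial (j :: s') F y 0 i'.
  by move=> Dy i'; rewrite derive_coord//; exact: dF.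
elim: k s i => [//|k IH] s i; split=> [x Dx|j]; last first.
  by apply: Ck_eq (IH (j :: s) i) => x Dx; rewrite pE.
have nD : nbhs x D by exact: open_nbhs_nbhs.
apply: differentiable_C1 => [|j].
  apply: filterS nD => y Dy j.
  exact: ((derivable_mxP _ _ _).1 (dF s j y Dy) 0 i).
have [K [cK nK KD]] := compact_nbhs Dx.
have [cF _] := bF K cK KD (j :: s).
(* [x] is interior to [K], so continuity within [K] is continuity at [x]. *)
have {}cF : {for x, continuous (iter_partial (j :: s) F)}.
  have := cF x; rewrite /continuous_at /=.
  by rewrite -nbhs_subspace_interior.
have : {for x, continuous (fun y => iter_partial (j :: s) F y 0 i)}.
  apply: (@continuous_comp _ _ _ _ (fun M : V => M 0 i)) => //.
  exact: coord_continuous.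
(* The partial derivative of the coordinate is known to be the coordinate of the iterated partial on
   [D] only, which is enough for a limit at [x]. *)
rewrite /prop_for /continuous_at pE//; apply: cvg_trans.
apply: near_eq_cvg; first exact: (@nbhs_filter V x).
by apply: (@filterS _ _ (@nbhs_filter V x) _ _ _ nD) => y Dy; rewrite pE.
Qed.

End Ck.

(** * Brackets of linear combinations *)

Section lie_lincomb.
Context {R : realType} {n : nat}.
Local Notation V := 'rV[R]_n.

(** Through its rows the Jacobian inherits the calculus rules of directional derivatives. *)
Lemma row_jacobian (F : V -> V) (x : V) (i : 'I_n) : differentiable F x ->
  row i (jacobian F x) = 'D_(delta_mx 0 i) F x.
Proof. by move=> dF; rewrite deriveEjacobian// rowE. Qed.

Lemma jacobianD (F G : V -> V) (x : V) :
  differentiable F x -> differentiable G x ->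
  jacobian (F + G) x = jacobian F x + jacobian G x.
Proof.
move=> dF dG; apply/row_matrixP => i.
rewrite (row_jacobian i (differentiableD dF dG)) deriveD;
  [|exact: diff_derivable..].
by rewrite [RHS]raddfD/=; congr (_ + _); apply/esym/row_jacobian.
Qed.

Lemma jacobianZ (c : R) (F : V -> V) (x : V) : differentiable F x ->
  jacobian (c *: F) x = c *: jacobian F x.
Proof.
move=> dF; apply/row_matrixP => i.
rewrite (row_jacobian i (differentiableZ c dF)) deriveZ;
  last exact: diff_derivable.
by rewrite [RHS]linearZ/=; congr (_ *: _); apply/esym/row_jacobian.
Qed.

Lemma jacobian_cst (c x : V) : jacobian (cst c) x = 0.
Proof.
apply/row_matrixP => i; rewrite row0 rowE.
by rewrite -(deriveEjacobian _ (differentiable_cst c x)) derive_cst.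
Qed.

Lemma near_eq_jacobian (F G : V -> V) (x : V) : {near x, F =1 G} ->
  differentiable F x -> jacobian F x = jacobian G x.
Proof.
move=> FG dF; have dG := near_eq_differentiable FG dF.
apply/row_matrixP => i.
rewrite [LHS](row_jacobian i dF) [RHS](row_jacobian i dG).
exact: near_eq_derive.
Qed.

Lemma jacobian_lincomb (I : finType) (P : pred I) (a : I -> R) (X : I -> V -> V)
    (x : V) : (forall i, P i -> differentiable (X i) x) ->
  let F := fun y => \sum_(i | P i) a i *: X i y in
  differentiable F x /\ jacobian F x = \sum_(i | P i) a i *: jacobian (X i) x.
Proof.
move=> dX F; have -> : F = \sum_(i | P i) a i *: X i.
  by apply/funext => y; rewrite fct_sumE.
elim/big_rec2 : _ => [|i J G Pi [dG JG]].
  by split; [exact: differentiable_cst|exact: jacobian_cst].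
have dZ := differentiableZ (a i) (dX i Pi).
split; first exact: differentiableD.
by rewrite jacobianD// jacobianZ ?JG//; exact: dX.
Qed.

(** The coefficients are constant in space, so the Jacobian of a combination is the combination of
    the Jacobians and the bracket is bilinear. The expansions of [F] and [G] are only asked for on
    the open set [D], where they may be differentiated. *)
Lemma lie_lincomb (D : set V) (I J : finType) (P : pred I) (Q : pred J)
    (a : I -> R) (c : J -> R) (X : I -> V -> V) (Y : J -> V -> V)
    (F G : V -> V) (x : V) :
  open D -> D x ->
  (forall i, P i -> differentiable (X i) x) ->
  (forall j, Q j -> differentiable (Y j) x) ->
  (forall y, D y -> F y = \sum_(i | P i) a i *: X i y) ->
  (forall y, D y -> G y = \sum_(j | Q j) c j *: Y j y) ->
  lie F G x =
  \sum_(i | P i) \sum_(j | Q j) (a i * c j) *: lie (X i) (Y j) x.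
Proof.
move=> oD Dx dX dY FE GE.
have nD : nbhs x D by exact: open_nbhs_nbhs.
have [dF JF] := jacobian_lincomb a dX.
have [dG JG] := jacobian_lincomb c dY.
have nF : {near x, (fun y => \sum_(i | P i) a i *: X i y) =1 F}.
  by apply: (@filterS _ _ (@nbhs_filter V x) _ _ _ nD) => y /FE.
have nG : {near x, (fun y => \sum_(i | Q i) c i *: Y i y) =1 G}.
  by apply: (@filterS _ _ (@nbhs_filter V x) _ _ _ nD) => y /GE.
rewrite /lie -(near_eq_jacobian nF dF) -(near_eq_jacobian nG dG) JF JG.
rewrite (FE x Dx) (GE x Dx) !mulmx_suml.
under eq_bigr do rewrite mulmx_sumr.
under [X in _ - X]eq_bigr do rewrite mulmx_sumr.
rewrite [X in _ - X]exchange_big/= -sumrB; apply: eq_bigr => i _.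
rewrite -sumrB; apply: eq_bigr => j _.
by rewrite scalerBr -!scalemxAl -!scalemxAr !scalerA (mulrC (c j)).
Qed.

Lemma lie_sym (F G : V -> V) (x : V) : lie G F x = - lie F G x.
Proof. by rewrite /lie opprB. Qed.

(** The square of indices splits into two triangles and the diagonal, where [B] vanishes; swapping
    the indices moves the lower triangle onto the upper one. *)
Lemma sum_antisym (m : nat) (B : 'I_m -> 'I_m -> V) :
  (forall i, B i i = 0) ->
  \sum_i \sum_j B i j =
  \sum_(i < m) \sum_(j < m | (i < j)%N) (B i j + B j i).
Proof.
move=> B0; transitivity
  (\sum_(i < m) (\sum_(j < m | (i < j)%N) B i j +
                  \sum_(j < m | (j < i)%N) B i j)).
  apply: eq_bigr => i _.
  rewrite (bigID (fun j : 'I_m => (i < j)%N))/=; congr (_ + _).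
  rewrite (bigID (fun j => j == i))/= [X in X + _]big1 ?add0r
    => [|j /andP[_ /eqP->]//].
  by apply: eq_bigl => j; rewrite -leqNgt ltn_neqAle andbC.
rewrite big_split/= [X in _ + X](exchange_big_dep predT)//= -big_split/=.
by apply: eq_bigr => i _; rewrite big_split.
Qed.

Lemma lie_self (F : V -> V) (x : V) : lie F F x = 0.
Proof. by rewrite /lie subrr. Qed.

(** Antisymmetry of the bracket folds the double sum onto increasing pairs and leaves 2 by 2 minors
    as coefficients. For the coefficients [U] and [v] these minors are the [W i j]. *)
Lemma lie_lincomb_same (D : set V) (m : nat) (a c : 'I_m -> R)
    (X : 'I_m -> V -> V) (F G : V -> V) (x : V) :
  open D -> D x -> (forall i, differentiable (X i) x) ->
  (forall y, D y -> F y = \sum_i a i *: X i y) ->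
  (forall y, D y -> G y = \sum_i c i *: X i y) ->
  lie F G x = \sum_(q : 'I_m * 'I_m | (q.1 < q.2)%N)
    (a q.1 * c q.2 - a q.2 * c q.1) *: lie (X q.1) (X q.2) x.
Proof.
move=> oD Dx dX FE GE.
rewrite (lie_lincomb oD Dx (fun i _ => dX i) (fun i _ => dX i) FE GE).
rewrite sum_antisym => [|i]; last by rewrite lie_self scaler0.
rewrite pair_big_dep/=; apply: eq_bigr => -[i j] _ /=.
by rewrite (lie_sym (X i) (X j)) scalerN -scalerBl.
Qed.

End lie_lincomb.

(** * Integrals of time-dependent linear combinations *)

Section integrals.
Context {R : realType}.
Local Notation mu := (@lebesgue_measure R).
Local Notation int0 a f := (\int[mu]_(s in `[0, a]) f s).

(** Continuity on the nonnegative half-line, one-sided at 0, since the inputs are controlled at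
    nonnegative times only. For negative [a] the segment is empty. *)
Definition continuous_ge0 (f : R -> R) : Prop :=
  forall a : R, {within `[0, a], continuous f}.

Lemma continuous_ge0_integrable (f : R -> R) (a : R) : continuous_ge0 f ->
  mu.-integrable `[0, a] (EFin \o f).
Proof.
move=> cf; apply: continuous_compact_integrable => //.
exact: segment_compact.
Qed.

Lemma continuous_ge0_cst (c : R) : continuous_ge0 (fun=> c).
Proof. by move=> a x; exact: cvg_cst. Qed.

Lemma continuous_ge0D (f g : R -> R) : continuous_ge0 f -> continuous_ge0 g ->
  continuous_ge0 (fun s => f s + g s).
Proof. by move=> cf cg a x; apply: cvgD; [exact: cf|exact: cg]. Qed.

Lemma continuous_ge0B (f g : R -> R) : continuous_ge0 f -> continuous_ge0 g ->
  continuous_ge0 (fun s => f s - g s).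
Proof. by move=> cf cg a x; apply: cvgB; [exact: cf|exact: cg]. Qed.

Lemma continuous_ge0M (f g : R -> R) : continuous_ge0 f -> continuous_ge0 g ->
  continuous_ge0 (fun s => f s * g s).
Proof. by move=> cf cg a x; apply: cvgM; [exact: cf|exact: cg]. Qed.

Lemma continuous_ge0_int (f : R -> R) : continuous_ge0 f ->
  continuous_ge0 (fun t => int0 t f).
Proof.
move=> cf a; have [a0|a0] := leP 0 a.
  exact: (parameterized_integral_continuous a0
    (@continuous_ge0_integrable f a cf)).
by rewrite set_itv_ge ?bnd_simp -?ltNge//; exact: continuous_subspace0.
Qed.

Lemma int0Zl (c a : R) (f : R -> R) : continuous_ge0 f ->
  int0 a (fun s => c * f s) = c * int0 a f.
Proof.
by move=> cf; apply: RintegralZl => //; exact: continuous_ge0_integrable.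
Qed.

Lemma int0D (a : R) (f g : R -> R) : continuous_ge0 f -> continuous_ge0 g ->
  int0 a (fun s => f s + g s) = int0 a f + int0 a g.
Proof.
by move=> cf cg; apply: RintegralD => //; exact: continuous_ge0_integrable.
Qed.

Lemma int0B (a : R) (f g : R -> R) : continuous_ge0 f -> continuous_ge0 g ->
  int0 a (fun s => f s - g s) = int0 a f - int0 a g.
Proof.
by move=> cf cg; apply: RintegralB => //; exact: continuous_ge0_integrable.
Qed.

Lemma int0_lincomb (I : finType) (P : pred I) (al : I -> R -> R) (c : I -> R)
    (a : R) : (forall i, continuous_ge0 (al i)) ->
  int0 a (fun s => \sum_(i | P i) al i s * c i) =
  \sum_(i | P i) int0 a (al i) * c i.
Proof.
move=> cal; pose F (r : seq I) s := \sum_(i <- r | P i) al i s * c i.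
have cF r : continuous_ge0 (F r).
  rewrite /F; elim: r => [|i r IH].
    under eq_fun do rewrite big_nil; exact: continuous_ge0_cst.
  under eq_fun do rewrite big_cons; case: (P i) => //.
  apply: continuous_ge0D => //; apply: continuous_ge0M => //.
  exact: continuous_ge0_cst.
rewrite -/(F (index_enum I)).
suff H r : int0 a (F r) = \sum_(i <- r | P i) int0 a (al i) * c i by exact: H.
elim: r => [|i r IH].
  rewrite big_nil (@eq_Rintegral _ _ _ mu _ (cst 0)) => [|s _];
    last exact: big_nil.
  by rewrite Rintegral_cst// mul0r.
rewrite big_cons; case: ifPn => [Pi|Pi]; last first.
  by rewrite -IH; apply: eq_Rintegral => s _; rewrite /F big_cons (negbTE Pi).
rewrite -IH mulrC -int0Zl// -int0D//; last first.
  by apply: continuous_ge0M => //; exact: continuous_ge0_cst.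
by apply: eq_Rintegral => s _; rewrite /F big_cons Pi mulrC.
Qed.

Context {n : nat}.
Local Notation V := 'rV[R]_n.

(** Stated at a fixed point [y] with vectors [X i], because the expansions of the integrands are
    available only at points of [D]. *)
Lemma time_int_lincomb (I : finType) (P : pred I) (al : I -> R -> R)
    (X : I -> V) (g : R -> V -> V) (a : R) (y : V) :
  (forall i, continuous_ge0 (al i)) ->
  (forall s, g s y = \sum_(i | P i) al i s *: X i) ->
  time_int a g y = \sum_(i | P i) int0 a (al i) *: X i.
Proof.
move=> cal gE; apply/rowP => j; rewrite mxE summxE.
under [RHS]eq_bigr do rewrite mxE.
rewrite -int0_lincomb//; apply: eq_Rintegral => s _.
by rewrite gE summxE; apply: eq_bigr => i _; rewrite mxE.
Qed.

(** Serves the fourth-order term, whose two families of brackets have different index types; the sum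
    type [I + J] joins them. *)
Lemma time_int_lincombD (I J : finType) (P : pred I) (Q : pred J)
    (al : I -> R -> R) (be : J -> R -> R) (X : I -> V) (Y : J -> V)
    (g : R -> V -> V) (a : R) (y : V) :
  (forall i, continuous_ge0 (al i)) -> (forall j, continuous_ge0 (be j)) ->
  (forall s, g s y =
     \sum_(i | P i) al i s *: X i + \sum_(j | Q j) be j s *: Y j) ->
  time_int a g y = \sum_(i | P i) int0 a (al i) *: X i +
                   \sum_(j | Q j) int0 a (be j) *: Y j.
Proof.
move=> cal cbe gE.
pose ga (k : I + J) := match k with inl i => al i | inr j => be j end.
pose Z (k : I + J) := match k with inl i => X i | inr j => Y j end.
pose PQ (k : I + J) := match k with inl i => P i | inr j => Q j end.
rewrite (@time_int_lincomb _ PQ ga Z) ?big_sumType//; first by case.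
by move=> s; rewrite gE big_sumType.
Qed.

End integrals.

(** * The averaging terms of \sum_i v_i X_i *)

Section averaging_terms.
Context {R : realType} {n m : nat} (D : set 'rV[R]_n) (openD : open D).
Local Notation V := 'rV[R]_n.
Local Notation mu := (@lebesgue_measure R).
Local Notation int0 a f := (\int[mu]_(s in `[0, a]) f s).
Variables (u : 'I_m -> R -> R) (k : 'I_m -> rat).
Local Notation v := (v u k).
Local Notation U := (U u k).
Local Notation W := (W u k).
Local Notation intW := (intW u k).
Local Notation alpha5 := (alpha5 u k).
Local Notation alpha8 := (alpha8 u k).
Local Notation alpha10 := (alpha10 u k).
Hypothesis cv : forall i, continuous_ge0 (v i).
Variable X : 'I_m -> V -> V.
(** Three derivatives, since the brackets of the fourth-order term are nested three deep and each
    level costs one. *)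
Hypothesis CX : forall i, Ck_field D 3 (X i).
Variable f : R -> V -> V.
Hypothesis fE : forall s y, f s y = \sum_i v i s *: X i y.

Let lt (q : 'I_m * 'I_m) := (q.1 < q.2)%N.
Let B q := lie (X q.1) (X q.2).
Let C (c : ('I_m * 'I_m) * 'I_m) := lie (B c.1) (X c.2).
Local Notation F1 t := (time_int t f).
Local Notation F2 t := (time_int t (fun q => lie (F1 q) (f q))).

Lemma continuous_U i : continuous_ge0 (U i).
Proof. exact: continuous_ge0_int. Qed.

Lemma continuous_W i j : continuous_ge0 (W i j).
Proof.
by apply: continuous_ge0B; apply: continuous_ge0M => //; exact: continuous_U.
Qed.

Lemma continuous_intW i j : continuous_ge0 (intW i j).
Proof. exact/continuous_ge0_int/continuous_W. Qed.

(** The integrand depends on the outer time as well; pulling those factors out of the integral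
    leaves products of continuous functions and integrals from 0. *)
Lemma continuous_alpha5 i1 i2 i3 i4 : continuous_ge0 (alpha5 i1 i2 i3 i4).
Proof.
have cvW i : continuous_ge0 (fun s => v i s * intW i1 i2 s).
  by apply: continuous_ge0M => //; exact: continuous_intW.
have -> : alpha5 i1 i2 i3 i4 = fun t =>
    v i4 t * int0 t (fun s => v i3 s * intW i1 i2 s) -
    v i3 t * int0 t (fun s => v i4 s * intW i1 i2 s).
  apply/funext => t; rewrite -!int0Zl// -int0B//.
  - by apply: eq_Rintegral => s _; ring.
  - by apply: continuous_ge0M => //; exact: continuous_ge0_cst.
  - by apply: continuous_ge0M => //; exact: continuous_ge0_cst.
apply: continuous_ge0B; apply: continuous_ge0M => //.
  exact: continuous_ge0_int.
exact: continuous_ge0_int.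
Qed.

Lemma continuous_alpha8 i1 i2 i3 i4 : continuous_ge0 (alpha8 i1 i2 i3 i4).
Proof.
apply: continuous_ge0M => //; apply: continuous_ge0_int.
by apply: continuous_ge0M => //; exact: continuous_intW.
Qed.

Lemma continuous_alpha10 i1 i2 i3 i4 : continuous_ge0 (alpha10 i1 i2 i3 i4).
Proof.
have cWU : continuous_ge0 (fun s => W i1 i2 s * U i4 s).
  by apply: continuous_ge0M; [exact: continuous_W|exact: continuous_U].
have -> : alpha10 i1 i2 i3 i4 = fun t =>
    v i3 t * int0 t (fun s => W i1 i2 s * U i4 s).
  apply/funext => t; rewrite -int0Zl//.
  by apply: eq_Rintegral => s _; ring.
by apply: continuous_ge0M => //; exact: continuous_ge0_int.
Qed.

Lemma C1_X i : Ck_field D 1 (X i). Proof. exact/Ck_fieldW/Ck_fieldW. Qed.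
Lemma C1_B q : Ck_field D 1 (B q).
Proof. by apply/(Ck_fieldW (k:=1))/Ck_field_lie. Qed.
Lemma C1_C c : Ck_field D 1 (C c).
Proof.
by apply: Ck_field_lie => //; [exact: Ck_field_lie|exact: Ck_fieldW].
Qed.

Lemma F1E t y : F1 t y = \sum_i U i t *: X i y.
Proof. exact: time_int_lincomb. Qed.

Lemma lie_F1_f s y : D y ->
  lie (F1 s) (f s) y = \sum_(q | lt q) W q.1 q.2 s *: B q y.
Proof.
move=> Dy; rewrite [LHS](@lie_lincomb_same _ _ D _ (U^~ s) (v^~ s) X)//.
- by apply: eq_bigr => q _; congr (_ *: _); rewrite /Defs.W; ring.
- by move=> i; exact: (Ck_field_differentiable (C1_X i)).
- by move=> z _; exact: F1E.
Qed.

Lemma F2E t y : D y -> F2 t y = \sum_(q | lt q) intW q.1 q.2 t *: B q y.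
Proof.
move=> Dy.
rewrite (time_int_lincomb (P := lt) (al := fun q => W q.1 q.2) (X := B^~ y))//.
  by move=> q; exact: continuous_W.
by move=> s; exact: lie_F1_f.
Qed.

Section order_le3.
Variables (eps T' : R).
Hypothesis U0 : forall i, U i T' = 0.

(** The coefficients of the integral of [f] are the [U i T']. The equality holds on the whole space,
    so [Lambda1] can be replaced inside the bracket occurring in [Lambda3]. *)
Lemma Lambda1_eq0 : Lambda1 eps T' f = fun=> 0.
Proof.
apply/funext => y; rewrite /Lambda1 F1E big1 ?scaler0// => i _.
by rewrite U0 scale0r.
Qed.

Lemma Lambda2E x : D x -> Lambda2 eps T' f x =
  (eps ^+ 2 / (2`!%:R * T')) *: \sum_(q | lt q) intW q.1 q.2 T' *: B q x.
Proof. by move=> Dx; rewrite /Lambda2 F2E. Qed.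

Lemma Lambda3E x : D x -> Lambda3 eps T' f x =
  (eps ^+ 3 / 3`!%:R * (2 / T')) *: \sum_(c : ('I_m * 'I_m) * 'I_m | lt c.1)
    int0 T' (fun t => U c.2 t * W c.1.1 c.1.2 t) *: lie (X c.2) (B c.1) x.
Proof.
move=> Dx; rewrite /Lambda3 Lambda1_eq0.
(* The zero field has zero value and zero Jacobian, so both terms of the bracket vanish. *)
have -> : lie (fun=> 0) (Lambda2 eps T' f) x = 0.
  by rewrite /lie mul0mx jacobian_cst mulmx0 subrr.
rewrite scaler0 add0r scalerA; congr (_ *: _).
apply: time_int_lincomb => [c|s].
  by apply: continuous_ge0M; [exact: continuous_U|exact: continuous_W].
rewrite [LHS](@lie_lincomb _ _ D _ _ xpredT lt (U^~ s)
  (fun q => W q.1 q.2 s) X B)//.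
- rewrite exchange_big pair_big_dep/=.
  by apply: eq_bigl => -[q i]; rewrite andbT.
- by move=> i _; exact: (Ck_field_differentiable (C1_X i)).
- by move=> q _; exact: (Ck_field_differentiable (C1_B q)).
- by move=> y _; exact: F1E.
- by move=> y Dy; exact: lie_F1_f.
Qed.

End order_le3.

(** Both arguments are combinations of the first-level brackets [B]: the left one with coefficients
    [intW], the right one with the minors of [v] at the times [s] and [t]. *)
Lemma lie_F2_ff s t y : D y ->
  lie (F2 s) (lie (f s) (f t)) y =
  \sum_(c : ('I_m * 'I_m) * ('I_m * 'I_m) | lt c.1 && lt c.2)
    ((v c.2.2 t * v c.2.1 s - v c.2.1 t * v c.2.2 s) * intW c.1.1 c.1.2 s) *:
    lie (B c.1) (B c.2) y.
Proof.
move=> Dy; rewrite [LHS](@lie_lincomb _ _ D _ _ lt lt (fun q => intW q.1 q.2 s)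
  (fun q => v q.1 s * v q.2 t - v q.2 s * v q.1 t) B B)//.
- by rewrite pair_big/=; apply: eq_bigr => c _; congr (_ *: _); ring.
- by move=> q _; exact: (Ck_field_differentiable (C1_B q)).
- by move=> q _; exact: (Ck_field_differentiable (C1_B q)).
- by move=> z Dz; exact: F2E.
- move=> z Dz; rewrite [LHS](@lie_lincomb_same _ _ D _ (v^~ s) (v^~ t) X)//.
  by move=> i; exact: (Ck_field_differentiable (C1_X i)).
Qed.

Lemma time_int_F2_ff t y : D y ->
  time_int t (fun s => lie (F2 s) (lie (f s) (f t))) y =
  \sum_(c : ('I_m * 'I_m) * ('I_m * 'I_m) | lt c.1 && lt c.2)
    alpha5 c.1.1 c.1.2 c.2.1 c.2.2 t *: lie (B c.1) (B c.2) y.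
Proof.
move=> Dy; rewrite /Defs.alpha5.
apply: time_int_lincomb => [c|s]; last exact: lie_F2_ff.
apply: continuous_ge0M; last exact: continuous_intW.
apply: continuous_ge0B; apply: continuous_ge0M => //.
  exact: continuous_ge0_cst.
exact: continuous_ge0_cst.
Qed.

Lemma lie_F2_f s y : D y ->
  lie (F2 s) (f s) y =
  \sum_(c | lt c.1) (intW c.1.1 c.1.2 s * v c.2 s) *: C c y.
Proof.
move=> Dy; rewrite [LHS](@lie_lincomb _ _ D _ _ lt xpredT
  (fun q => intW q.1 q.2 s)
  (v^~ s) B X)//.
- by rewrite pair_big/=; apply: eq_bigl => c; rewrite andbT.
- by move=> q _; exact: (Ck_field_differentiable (C1_B q)).
- by move=> i _; exact: (Ck_field_differentiable (C1_X i)).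
- by move=> z Dz; exact: F2E.
Qed.

Lemma lie_time_int_F2_f t y : D y ->
  lie (time_int t (fun s => lie (F2 s) (f s))) (f t) y =
  \sum_(c : ('I_m * 'I_m) * 'I_m * 'I_m | lt c.1.1)
    alpha8 c.1.1.1 c.1.1.2 c.1.2 c.2 t *: lie (C c.1) (X c.2) y.
Proof.
move=> Dy; rewrite [LHS](@lie_lincomb _ _ D _ _ (fun c => lt c.1) xpredT
  (fun c => int0 t (fun s => intW c.1.1 c.1.2 s * v c.2 s)) (v^~ t) C X)//.
- rewrite pair_big/=; apply: eq_big => c; first by rewrite andbT.
  by move=> _; rewrite mulrC.
- by move=> c _; exact: (Ck_field_differentiable (C1_C c)).
- by move=> i _; exact: (Ck_field_differentiable (C1_X i)).
- move=> z Dz; apply: time_int_lincomb => [c|s]; last exact: lie_F2_f.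
  by apply: continuous_ge0M => //; exact: continuous_intW.
Qed.

Lemma lie_F1_lie_f s t y : D y ->
  lie (F1 s) (lie (lie (F1 s) (f s)) (f t)) y =
  \sum_(c : ('I_m * 'I_m) * 'I_m * 'I_m | lt c.1.1)
    (W c.1.1.1 c.1.1.2 s * v c.1.2 t * U c.2 s) *: lie (X c.2) (C c.1) y.
Proof.
move=> Dy; rewrite [LHS](@lie_lincomb _ _ D _ _ xpredT (fun c => lt c.1) (U^~ s)
  (fun c => W c.1.1 c.1.2 s * v c.2 t) X C)//.
- rewrite exchange_big pair_big/=; apply: eq_big => c; first by rewrite andbT.
  by move=> _; rewrite mulrC.
- by move=> i _; exact: (Ck_field_differentiable (C1_X i)).
- by move=> c _; exact: (Ck_field_differentiable (C1_C c)).
- by move=> z _; exact: F1E.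
- move=> z Dz; rewrite [LHS](@lie_lincomb _ _ D _ _ lt xpredT
    (fun q => W q.1 q.2 s)
    (v^~ t) B X)//.
  + by rewrite pair_big/=; apply: eq_bigl => c; rewrite andbT.
  + by move=> q _; exact: (Ck_field_differentiable (C1_B q)).
  + by move=> i _; exact: (Ck_field_differentiable (C1_X i)).
  + by move=> z' Dz'; exact: lie_F1_f.
Qed.

Lemma time_int_F1_lie_f t y : D y ->
  time_int t (fun s => lie (F1 s) (lie (lie (F1 s) (f s)) (f t))) y =
  \sum_(c : ('I_m * 'I_m) * 'I_m * 'I_m | lt c.1.1)
    alpha10 c.1.1.1 c.1.1.2 c.1.2 c.2 t *: lie (X c.2) (C c.1) y.
Proof.
move=> Dy; rewrite /Defs.alpha10.
apply: time_int_lincomb => [c|s]; last exact: lie_F1_lie_f.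
apply: continuous_ge0M; last exact: continuous_U.
apply: continuous_ge0M; first exact: continuous_W.
exact: continuous_ge0_cst.
Qed.

(** The three summands have coefficients [alpha5], [alpha8] and [alpha10]. The third carries the
    brackets of the second with their arguments exchanged, so the two merge into the difference of
    [alpha8] and [alpha10]. *)
Lemma Lambda4E (eps T' : R) x : D x -> Lambda4 eps T' f x =
  (2 * eps ^+ 4 / (4`!%:R * T')) *:
    (\sum_(c : ('I_m * 'I_m) * ('I_m * 'I_m) | lt c.1 && lt c.2)
       int0 T' (alpha5 c.1.1 c.1.2 c.2.1 c.2.2) *: lie (B c.1) (B c.2) x +
     \sum_(c : ('I_m * 'I_m) * 'I_m * 'I_m | lt c.1.1)
       int0 T' (fun t => alpha8 c.1.1.1 c.1.1.2 c.1.2 c.2 t -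
                         alpha10 c.1.1.1 c.1.1.2 c.1.2 c.2 t) *:
       lie (C c.1) (X c.2) x).
Proof.
move=> Dx; rewrite /Lambda4; congr (_ *: _).
apply: time_int_lincombD => [c|c|t]; first exact: continuous_alpha5.
  apply: continuous_ge0B; first exact: continuous_alpha8.
  exact: continuous_alpha10.
apply: (etrans (congr2 +%R (congr2 +%R (time_int_F2_ff t Dx)
  (lie_time_int_F2_f t Dx)) (time_int_F1_lie_f t Dx))).
rewrite -addrA.
congr (_ + _); rewrite -big_split/=; apply: eq_bigr => c _.
by rewrite (lie_sym (C c.1)) scalerN -scalerBl.
Qed.

End averaging_terms.

(** * The inputs in the time tau: continuity and zero mean *)

Lemma lipschitz_continuous_ge0 (R : realType) (f : R -> R) (N : R) : 0 < N ->
  (forall s t, 0 <= s -> 0 <= t -> `|f s - f t| <= N * `|s - t|) ->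
  continuous_ge0 f.
Proof.
move=> N0 lipf a; apply/subspace_continuousP => t /=.
rewrite in_itv/= => /andP[t0 ta].
apply/cvgrPdist_le => e e0; near=> s.
have /andP[s0 sa] : 0 <= s <= a.
  suff : `[0, a]%classic s by rewrite /= in_itv.
  by near: s; exact: withinT.
rewrite (le_trans (lipf _ _ t0 s0))// -ler_pdivlMl//.
near: s; apply: cvg_within; apply/nbhs_ballP; exists (N^-1 * e).
  by rewrite /= mulr_gt0// invr_gt0.
by move=> s; rewrite -ball_normE/= => /ltW.
Unshelve. all: by end_near. Qed.

Section inputs.
Context {R : realType} {m : nat}.
Local Notation mu := (@lebesgue_measure R).
Variables (u : 'I_m -> R -> R) (k : 'I_m -> rat) (omega T : R) (i : 'I_m).
Hypotheses (homega : 0 < omega) (hT : 0 < T).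
Hypothesis ui : admissible_input u k omega T i.

Lemma v_rescale t : v u k i (omega * t) = u i (ratr (k i) * omega * t).
Proof. by rewrite /v mulrA. Qed.

Lemma continuous_v : continuous_ge0 (v u k i).
Proof.
have [_ [N N0 lipN] _ _ _] := ui.
(* A Lipschitz constant [N] in the time t becomes [N / omega] in the time tau = omega t. *)
apply: (@lipschitz_continuous_ge0 _ _ (N / omega)) => [|s t s0 t0].
  by rewrite divr_gt0.
rewrite -(divfK (lt0r_neq0 homega) s) -(divfK (lt0r_neq0 homega) t).
rewrite !(mulrC _ omega) !v_rescale.
have inv0 : 0 <= omega^-1 by rewrite invr_ge0 ltW.
apply: le_trans (lipN _ _ (mulr_ge0 s0 inv0) (mulr_ge0 t0 inv0)) _.
by rewrite -mulrBr normrM (gtr0_norm homega) mulrA divfK ?lt0r_neq0.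
Qed.

(** The substitution tau = omega t turns this integral into [omega] times the integral of the input
    over one period [T], which is zero by assumption. *)
Lemma U_period : U u k i (omega * T) = 0.
Proof.
have [_ [N N0 lipN] _ _ w0] := ui.
pose F (t : R) := omega * t.
have dF (t : R) : is_derive t (1 : R) F omega.
  rewrite (_ : F = omega *: (id : R -> R))//.
  by apply: is_derive_eq; rewrite /GRing.scale/= mulr1.
have dFE : derive1 F = cst omega.
  by apply/funext => t; rewrite derive1E; exact: derive_val.
have cF : continuous F by move=> t; exact: mulrl_continuous.
have H := @integration_by_substitution_increasing R F (v u k i) 0 T (ltW hT).
(* Both endpoints are written as values of [F], to match the substitution formula. *)
rewrite /U /Rintegral -[X in `[X, _]](mulr0 omega) -/(F 0) -/(F T).
rewrite H; last 6 first.
- by move=> x y _ _ xy; rewrite /F ltr_pM2l.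
- by rewrite dFE => x _; exact: cst_continuous.
- by rewrite dFE; exact: is_cvg_cst.
- by rewrite dFE; exact: is_cvg_cst.
- split; [by move=> x _; exact: ex_derive| |].
  + by apply: cvg_at_right_filter; exact: cF.
  + by apply: cvg_at_left_filter; exact: cF.
- by rewrite /F mulr0; exact: continuous_v.
rewrite -/(Rintegral _ _ _).
rewrite (@eq_Rintegral _ _ _ mu _ (fun t => omega * v u k i (F t))).
  rewrite RintegralZl//.
    rewrite (@eq_Rintegral _ _ _ mu _ (fun t => u i (ratr (k i) * omega * t))).
      by rewrite w0 mulr0.
    by move=> t _; rewrite v_rescale.
  apply: continuous_ge0_integrable.
  apply: (@lipschitz_continuous_ge0 _ _ N) => // s t s0 t0.
  by rewrite !v_rescale; exact: lipN.
by move=> t _; rewrite /= dFE mulrC.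
Qed.

End inputs.

(** * Solutions under a linear change of time *)

Section time_change.
Context {R : realType} {n : nat}.
Local Notation V := 'rV[R]_n.

Lemma eq_solves (D : set V) (J : set R) (F G : V -> V) (z : R -> V) :
  (forall x, D x -> F x = G x) -> solves D J F z -> solves D J G z.
Proof. by move=> FG sF t Jt; have [Dz] := sF t Jt; rewrite FG. Qed.

Lemma solves_rescale (D : set V) (J : set R) (F : V -> V) (z : R -> V) (c : R) :
  c != 0 -> solves D J F z ->
  solves D [set t | J (c * t)] (fun x => c *: F x) (fun t => z (c * t)).
Proof.
move=> c0 sF t Jct; have [Dz zF] := sF _ Jct; split=> //.
(* Multiplication by [c] respects the punctured neighbourhoods within the two time sets; [c != 0]
   keeps the puncture. *)
have cvc : c * s @[s --> within [set s | J (c * s)] t^'] --> within J (c * t)^'.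
  move=> A; rewrite /= /within /dnbhs /within /= => nA.
  have /= : c * s @[s --> t] --> c * t by exact: mulrl_continuous.
  move=> /(_ _ nA); rewrite /= !nbhs_simpl/=; apply: filterS => s /= H st Js.
  by apply: H => //; apply: contra_neq st => /(mulfI c0).
have cz := cvg_comp _ _ cvc zF.
rewrite (_ : (fun s => _) = fun s =>
    c *: ((c * s - c * t)^-1 *: (z (c * s) - z (c * t)))).
  by apply: cvgZl_tmp; exact: cz.
apply/funext => s; rewrite scalerA -mulrBr; congr (_ *: _).
by rewrite invfM mulrA divff// mul1r.
Qed.

End time_change.

(** * Powers of omega and the coefficients of the Lie bracket system *)

Lemma lieZ (R : realType) (n : nat) (D : set 'rV[R]_n) (a c : R)
    (X Y F G : 'rV[R]_n -> 'rV[R]_n) (x : 'rV[R]_n) :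
  open D -> D x -> Ck_field D 1 X -> Ck_field D 1 Y ->
  (forall y, D y -> F y = a *: X y) -> (forall y, D y -> G y = c *: Y y) ->
  lie F G x = (a * c) *: lie X Y x.
Proof.
move=> oD Dx CX CY FE GE.
rewrite [LHS](@lie_lincomb _ _ D 'I_1 'I_1 predT predT (fun=> a) (fun=> c)
  (fun=> X) (fun=> Y))//; first by rewrite !big_ord1.
- by move=> _ _; exact: Ck_field_differentiable CX Dx.
- by move=> _ _; exact: Ck_field_differentiable CY Dx.
- by move=> y Dy; rewrite big_ord1; exact: FE.
- by move=> y Dy; rewrite big_ord1; exact: GE.
Qed.

Section control_system.
Context {R : realType} {n m : nat} (D : set 'rV[R]_n) (openD : open D).
Local Notation V := 'rV[R]_n.
Variables (b : 'I_m -> V -> V) (u : 'I_m -> R -> R) (k : 'I_m -> rat).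
Variables (p : 'I_m -> R) (omega pstar T' : R).
Hypotheses (homega : 0 < omega) (hT' : T' != 0).
Hypothesis Cb : forall i, Ck_field D 3 (b i).
Hypothesis cv : forall i, continuous_ge0 (v u k i).
Hypothesis U0 : forall i, U u k i T' = 0.

Let c (i : 'I_m) := omega `^ (p i - pstar).
Let X (i : 'I_m) (y : V) := c i *: b i y.
Let eps := avg_eps omega pstar.
Let f := avg_f b u k p omega pstar.

Let fE s y : f s y = \sum_i v u k i s *: X i y.
Proof. by apply: eq_bigr => i _; rewrite /X scalerA mulrC. Qed.

Let CX i : Ck_field D 3 (X i). Proof. exact: Ck_fieldZ. Qed.

Let powD x y : omega `^ (x + y) = omega `^ x * omega `^ y.
Proof. by rewrite powRD ?(gt_eqF homega) ?implybT. Qed.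

Let Cb1 i : Ck_field D 1 (b i). Proof. exact/Ck_fieldW/Ck_fieldW. Qed.

Let Cbb i j : Ck_field D 2 (lie (b i) (b j)). Proof. exact: Ck_field_lie. Qed.

Let BE i j y : D y -> lie (X i) (X j) y = (c i * c j) *: lie (b i) (b j) y.
Proof. by move=> Dy; exact: (lieZ openD Dy (Cb1 i) (Cb1 j)). Qed.

Let CE i j l y : D y -> lie (lie (X i) (X j)) (X l) y =
  (c i * c j * c l) *: lie (lie (b i) (b j)) (b l) y.
Proof.
move=> Dy; apply: (lieZ openD Dy (Ck_fieldW (Cbb i j)) (Cb1 l)) => //.
by move=> z Dz; exact: BE.
Qed.

(** In a term of order r, the factor [omega], the r-th power of [eps] and the r scalings [c]
    multiply to omega raised to the sum of the [p] minus (r - 1); [pstar] cancels. The same count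
    gives the third and fourth orders. *)
Let Lambda2_L2 x : D x -> L2 b u k p omega T' x = omega *: Lambda2 eps T' f x.
Proof.
move=> Dx; rewrite (Lambda2E openD cv CX fE)// /L2 pair_big_dep/= !scaler_sumr.
apply: eq_bigr => q _; rewrite BE// !scalerA; congr (_ *: _).
have -> : nu2 u k p omega T' q.1 q.2 = omega `^ (p q.1 + p q.2 - 1) / (2 * T') *
  intW u k q.1 q.2 T' by [].
have -> : omega `^ (p q.1 + p q.2 - 1) = omega * eps ^+ 2 * (c q.1 * c q.2).
  rewrite -[X in _ = X * _ * _]powRr1 ?ltW// expr2 /eps /avg_eps /c -!powD.
  by congr (_ `^ _); ring.
have -> : 2`!%:R = 2 :> R by [].
by field.
Qed.

Let Lambda3_L3 x : D x -> L3 b u k p omega T' x = omega *: Lambda3 eps T' f x.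
Proof.
move=> Dx; rewrite (Lambda3E openD cv CX fE eps U0)// /L3.
rewrite pair_big_dep/= pair_big/= !scaler_sumr.
apply: eq_big => [q|[[i j] l] _ /=]; first by rewrite andbT.
rewrite [X in _ = _ *: (_ *: (_ *: X))](lieZ openD Dx
  (Cb1 l) (Ck_fieldW (Cbb i j)) (fun y _ => erefl)
  (fun y Dy => BE i j Dy)) !scalerA; congr (_ *: _).
rewrite /nu3; set I := Rintegral _ _ _.
have -> : omega `^ (p i + p j + p l - 2) = omega * eps ^+ 3 * (c i * c j * c l).
  rewrite -[X in _ = X * _ * _]powRr1 ?ltW// !exprS expr0 mulr1.
  by rewrite /eps /avg_eps /c -!powD; congr (_ `^ _); ring.
have -> : 3`!%:R = 6 :> R by [].
by field.
Qed.

(** Both families of fourth-order coefficients share this prefactor; the 12 is 4! / 2. *)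
Let beta_scale i j l o :
  omega `^ (p i + p j + p l + p o - 3) / (12 * T') =
  omega * (2 * eps ^+ 4 / (4`!%:R * T')) * (c i * c j * c l * c o).
Proof.
have -> : omega `^ (p i + p j + p l + p o - 3) =
    omega * eps ^+ 4 * (c i * c j * c l * c o).
  rewrite -[X in _ = X * _ * _]powRr1 ?ltW// !exprS expr0 mulr1.
  by rewrite /eps /avg_eps /c -!powD; congr (_ `^ _); ring.
have -> : 4`!%:R = 24 :> R by [].
by field.
Qed.

Let Lambda4_L4 x : D x -> L4 b u k p omega T' x = omega *: Lambda4 eps T' f x.
Proof.
move=> Dx; rewrite (Lambda4E openD cv CX fE)// /L4 !scalerDr; congr (_ + _).
  rewrite pair_big_dep/=; under eq_bigr do rewrite pair_big_dep/=.
  rewrite pair_big_dep/= !scaler_sumr; apply: eq_bigr => -[[i j] [l o]] _ /=.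
  rewrite [X in _ = _ *: (_ *: (_ *: X))](lieZ openD Dx
    (Ck_fieldW (Cbb i j)) (Ck_fieldW (Cbb l o))
    (fun y Dy => BE i j Dy) (fun y Dy => BE l o Dy)) !scalerA; congr (_ *: _).
  by rewrite /beta1 beta_scale; ring.
rewrite pair_big_dep/= pair_big/= pair_big/= !scaler_sumr.
apply: eq_big => [q|[[[i j] l] o] _ /=]; first by rewrite !andbT.
rewrite [X in _ = _ *: (_ *: (_ *: X))](lieZ openD Dx
  (Ck_field_lie openD (Cbb i j) (Ck_fieldW (Cb l))) (Cb1 o)
  (fun y Dy => CE i j l Dy) (fun y _ => erefl)) !scalerA; congr (_ *: _).
by rewrite /beta2 beta_scale; ring.
Qed.

Lemma Lterm_Lambda (i : nat) x : (1 <= i <= 4)%N -> D x ->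
  Lterm b u k p omega T' i x = omega *: Lambda eps T' f i x.
Proof.
case: i => [|[|[|[|[|i]]]]]// _ Dx /=.
- by rewrite (Lambda1_eq0 cv fE eps U0) scaler0.
- exact: Lambda2_L2.
- exact: Lambda3_L3.
- exact: Lambda4_L4.
Qed.

Lemma averaging_lie_bracket_system (b0 : V -> V) (r : nat) x :
  (r <= 4)%N -> D x ->
  omega *: averaging b0 b u k p omega pstar T' r x =
  lie_bracket_system b0 b u k p omega T' r x.
Proof.
move=> r4 Dx; rewrite /averaging /averaged_field /lie_bracket_system scalerDr.
rewrite scalerA divff ?gt_eqF// scale1r scaler_sumr; congr (_ + _).
(* The range of summation is kept as a hypothesis on [i], which the termwise identity requires. *)
rewrite big_seq [RHS]big_seq; apply: eq_bigr => i.
rewrite mem_index_iota => /andP[i1 ir]; rewrite Lterm_Lambda// i1/=.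
by rewrite (leq_trans _ r4).
Qed.

End control_system.

Theorem theorem4 (R : realType) (n m : nat) (D : set 'rV[R]_n)
  (b0 : 'rV[R]_n -> 'rV[R]_n) (b : 'I_m -> 'rV[R]_n -> 'rV[R]_n)
  (u : 'I_m -> R -> R) (k : 'I_m -> rat) (p : 'I_m -> R)
  (omega pstar : R) (L : rat)
  (hD : open D)
  (hp : forall i, 0 < p i < 1)
  (hk : forall i, 0 < k i)
  (homega : 0 < omega)
  (hpstar : 0 < pstar < 1)
  (hL : is_rat_lcm (fun i => (k i)^-1) L)
  (A1 : smooth_bounded D b0 /\ forall i, smooth_bounded D (b i))
  (A2 : forall i, admissible_input u k omega (2 * pi / omega * ratr L) i) :
  let T' := 2 * pi * ratr L in
  (forall i : nat, (1 <= i <= 4)%N -> forall x, D x ->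
     Lterm b u k p omega T' i x =
     omega *: Lambda (avg_eps omega pstar) T' (avg_f b u k p omega pstar) i x)
  /\
  (forall r : nat, (1 <= r <= 4)%N ->
     (forall x, D x ->
        omega *: averaging b0 b u k p omega pstar T' r x =
        lie_bracket_system b0 b u k p omega T' r x) /\
     (forall (J : set R) (xbar : R -> 'rV[R]_n), is_interval J ->
        (solves D J (averaging b0 b u k p omega pstar T' r) xbar <->
         solves D [set t | J (omega * t)]
           (lie_bracket_system b0 b u k p omega T' r)
           (fun t => xbar (omega * t))))).
Proof.
move=> T'; have w0 : omega != 0 by rewrite gt_eqF.
have L0 : 0 < L by case: hL => -[].
have T'0 : 0 < T' by rewrite /T' mulr_gt0 ?ltr0q// mulr_gt0 ?pi_gt0.
(* [T'] is the period [T] of the inputs measured in the time tau, so their zero mean yields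
   [U i T' = 0]. *)
have T'E : omega * (2 * pi / omega * ratr L) = T' by rewrite /T'; field.
have T0 : 0 < 2 * pi / omega * ratr L by rewrite -(pmulr_rgt0 _ homega) T'E.
have Cb i : Ck_field D 3 (b i) by exact: smooth_bounded_Ck (A1.2 i).
have cv i : continuous_ge0 (v u k i) by exact: continuous_v homega (A2 i).
have U0 i : U u k i T' = 0 by rewrite -T'E; exact: U_period.
have avgE r x : (r <= 4)%N -> D x ->
    omega *: averaging b0 b u k p omega pstar T' r x =
    lie_bracket_system b0 b u k p omega T' r x.
  move=> r4 Dx; apply: (averaging_lie_bracket_system hD) => //.
  by rewrite gt_eqF.
split=> [i hi x Dx|r /andP[_ r4]].
  by apply: (Lterm_Lambda hD) => //; rewrite gt_eqF.
split=> [x Dx|J xbar _]; first exact: avgE.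
split=> [sx|sz].
  apply: eq_solves (solves_rescale w0 sx) => x Dx; exact: avgE.
(* For the converse, rescaling time by the inverse of [omega] recovers [J] and [xbar]. *)
have w'0 : omega^-1 != 0 by rewrite invr_eq0.
have := solves_rescale w'0 sz.
have -> : [set t | [set s | J (omega * s)] (omega^-1 * t)] = J.
  by apply/funext => t; rewrite /= mulVKf.
have -> : (fun t => xbar (omega * (omega^-1 * t))) = xbar.
  by apply/funext => t; rewrite mulVKf.
apply: eq_solves => x Dx.
by rewrite -avgE// scalerA mulVf// scale1r.
Qed.
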